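(* Let $\mathcal{A}\subseteq\{\mathsf{N},\mathsf{M},\mathsf{C}\}$. If a sequent $\Gamma\Rightarrow\Delta$ is derivable (as a one-component linear nested sequent) in $\mathsf{LNS}_{\mathsf{E}\mathcal{A}}$ extended with contraction, then it is derivable in the sequent calculus $\mathsf{G}_{\mathsf{E}\mathcal{A}}$ extended with contraction. Hence, if $\;\Rightarrow A$ is derivable in $\mathsf{LNS}_{\mathsf{E}\mathcal{A}}$ extended with contraction and weakening, then $A\in\mathsf{E}\mathcal{A}$.
   Context: Formulas: propositional variables, $\bot,\top,\neg,\land,\lor,\to,\Box$. $\mathsf{E}\mathcal{A}$ is the smallest set containing the propositional tautologies and the axioms in $\mathcal{A}$ ($\mathsf{M}: \Box(A\land B)\to(\Box A\land\Box B)$, $\mathsf{C}: (\Box A\land\Box B)\to\Box(A\land B)$, $\mathsf{N}: \Box\top$), closed under modus ponens and rule (E): from $A\to B$ and $B\to A$ infer $\Box A\to\Box B$. Structures: $\mathcal{X}::=\Gamma\Rightarrow\Delta\mid\Gamma\Rightarrow\Delta\,/_{\mathsf e}(\Sigma\Rightarrow\Pi;\Omega\Rightarrow\Theta)\mid\Gamma\Rightarrow\Delta\,/\,\mathcal{X}$ (finite multisets); $\mathcal{S}\{\Gamma\Rightarrow\Delta\}$ has a distinguished component, $\mathcal{G}/\Gamma\Rightarrow\Delta$ has last component $\Gamma\Rightarrow\Delta$. $\mathsf{LNS}_{\mathsf{E}\mathcal{A}}$: propositional rules (zero-premiss $\mathcal{S}\{\Gamma,p\Rightarrow p,\Delta\}$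 with $p$ atomic, $\mathcal{S}\{\Gamma,\bot\Rightarrow\Delta\}$, $\mathcal{S}\{\Gamma\Rightarrow\top,\Delta\}$, and the standard two-sided invertible rules for $\neg,\land,\lor,\to$ on one component), not applicable to sequents inside $/_{\mathsf e}$; $\Box^{\mathsf e}_R$: $\mathcal{G}/\Gamma\Rightarrow\Delta/_{\mathsf e}(\Rightarrow B;B\Rightarrow)$ / $\mathcal{G}/\Gamma\Rightarrow\Box B,\Delta$; $\Box^{\mathsf e}_L$: $\mathcal{G}/\Gamma\Rightarrow\Delta/\Sigma,A\Rightarrow\Pi$ and $\mathcal{G}/\Gamma\Rightarrow\Delta/\Omega\Rightarrow A,\Theta$ / $\mathcal{G}/\Gamma,\Box A\Rightarrow\Delta/_{\mathsf e}(\Sigma\Rightarrow\Pi;\Omega\Rightarrow\Theta)$; if $\mathsf{N}\in\mathcal{A}$: $\mathcal{G}/\Gamma\Rightarrow\Delta/\Rightarrow B$ / $\mathcal{G}/\Gamma\Rightarrow\Box B,\Delta$; if $\mathsf{M}\in\mathcal{A}$: $\mathcal{G}/_{\mathsf e}(\Sigma\Rightarrow\Pi;\Omega,\bot\Rightarrow\Theta)$ / $\mathcal{G}/_{\mathsf e}(\Sigma\Rightarrow\Pi;\Omega\Rightarrow\Theta)$; if $\mathsf{C}\in\mathcal{A}$: $\mathcal{G}/\Gamma\Rightarrow\Delta/_{\mathsf e}(\Sigma,A\Rightarrow\Pi;\Omega\Rightarrow\Theta)$ and $\mathcal{G}/\Gamma\Rightarrow\Delta/\Omega\Rightarrow A,\Theta$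 / $\mathcal{G}/\Gamma,\Box A\Rightarrow\Delta/_{\mathsf e}(\Sigma\Rightarrow\Pi;\Omega\Rightarrow\Theta)$. Contraction and weakening: usual left/right rules inside a component. Sequent calculus $\mathsf{G}$: the same propositional rules on plain sequents. Modal sequent rules: (E): from $A\Rightarrow B$ and $B\Rightarrow A$ infer $\Gamma,\Box A\Rightarrow\Box B,\Delta$; (M): from $A\Rightarrow B$ infer $\Gamma,\Box A\Rightarrow\Box B,\Delta$; (N): from $\Rightarrow A$ infer $\Gamma\Rightarrow\Box A,\Delta$; ($\mathsf{E}n$): from $A_1,\dots,A_n\Rightarrow B$ and $B\Rightarrow A_1$, ..., $B\Rightarrow A_n$ infer $\Gamma,\Box A_1,\dots,\Box A_n\Rightarrow\Box B,\Delta$; ($\mathsf{M}n$): from $A_1,\dots,A_n\Rightarrow B$ infer $\Gamma,\Box A_1,\dots,\Box A_n\Rightarrow\Box B,\Delta$. $\mathsf{G}_{\mathsf{E}\mathcal{A}}$ is $\mathsf{G}$ plus: for $\mathsf{E}$: (E); $\mathsf{EN}$: (E),(N); $\mathsf{EC}$: ($\mathsf{E}n$), $n\geq1$; $\mathsf{ECN}$: ($\mathsf{E}n$), $n\geq1$, and (N); $\mathsf{EM}$: (M); $\mathsf{EMN}$: (M),(N); $\mathsf{EMC}$: ($\mathsf{M}n$), $n\geq1$; $\mathsf{EMCN}$: ($\mathsf{M}n$), $n\geq0$. *)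

(* Defs.v *)
From HB Require Import structures.
From mathcomp Require Import all_boot.
From mathcomp Require Import finmap multiset.

Set Implicit Arguments.
Unset Strict Implicit.
Unset Printing Implicit Defensive.

Local Open Scope mset_scope.

Inductive form : Type :=
  | Var of nat
  | Bot
  | Top
  | Neg of form
  | And of form & form
  | Or of form & form
  | Imp of form & form
  | Box of form.

(* {mset form} needs a choiceType; we encode formulas as generic trees. *)
Fixpoint tree_of_form (A : form) : GenTree.tree nat :=
  match A with
  | Var p => GenTree.Leaf p
  | Bot => GenTree.Node 0 [::]
  | Top => GenTree.Node 1 [::]
  | Neg B => GenTree.Node 2 [:: tree_of_form B]
  | And B C => GenTree.Node 3 [:: tree_of_form B; tree_of_form C]
  | Or B C => GenTree.Node 4 [:: tree_of_form B; tree_of_form C]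
  | Imp B C => GenTree.Node 5 [:: tree_of_form B; tree_of_form C]
  | Box B => GenTree.Node 6 [:: tree_of_form B]
  end.

Fixpoint form_of_tree (t : GenTree.tree nat) : form :=
  match t with
  | GenTree.Leaf p => Var p
  | GenTree.Node 1 _ => Top
  | GenTree.Node 2 [:: t1] => Neg (form_of_tree t1)
  | GenTree.Node 3 [:: t1; t2] => And (form_of_tree t1) (form_of_tree t2)
  | GenTree.Node 4 [:: t1; t2] => Or (form_of_tree t1) (form_of_tree t2)
  | GenTree.Node 5 [:: t1; t2] => Imp (form_of_tree t1) (form_of_tree t2)
  | GenTree.Node 6 [:: t1] => Box (form_of_tree t1)
  | _ => Bot
  end.

Lemma tree_of_formK : cancel tree_of_form form_of_tree.
Proof.
by elim=> //= [B -> | B -> C -> | B -> C -> | B -> C -> | B ->].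
Qed.

HB.instance Definition _ := Countable.copy form (can_type tree_of_formK).

Inductive modal_axiom : Type := AxN | AxM | AxC.

(* Truth value of a formula when every variable and every boxed formula is
   treated as an atom. *)
Fixpoint eval (v : nat -> bool) (b : form -> bool) (A : form) : bool :=
  match A with
  | Var p => v p
  | Bot => false
  | Top => true
  | Neg B => ~~ eval v b B
  | And B C => eval v b B && eval v b C
  | Or B C => eval v b B || eval v b C
  | Imp B C => eval v b B ==> eval v b C
  | Box B => b B
  end.

Definition tautology (A : form) : Prop := forall v b, eval v b A.

Inductive axiom_instance : modal_axiom -> form -> Prop :=
  | instM A B :
      axiom_instance AxM (Imp (Box (And A B)) (And (Box A) (Box B)))
  | instC A B :
      axiom_instance AxC (Imp (And (Box A) (Box B)) (Box (And A B)))
  | instN : axiom_instance AxN (Box Top).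

Inductive Hilbert (Ax : {pred modal_axiom}) : form -> Prop :=
  | H_taut A : tautology A -> Hilbert Ax A
  | H_axiom a A : a \in Ax -> axiom_instance a A -> Hilbert Ax A
  | H_mp A B : Hilbert Ax (Imp A B) -> Hilbert Ax A -> Hilbert Ax B
  | H_E A B : Hilbert Ax (Imp A B) -> Hilbert Ax (Imp B A) ->
      Hilbert Ax (Imp (Box A) (Box B)).

Definition sequent : Type := ({mset form} * {mset form})%type.

Notation "Γ ⇒ Δ" := ((Γ, Δ) : sequent) (at level 85, no associativity).

(* Rules on single sequents: a relation between the premisses and the
   conclusion, shared by the sequent and the linear nested sequent calculi. *)
Inductive prop_rule : seq sequent -> sequent -> Prop :=
  | R_init Γ Δ p : prop_rule [::] (Var p +` Γ ⇒ Var p +` Δ)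
  | R_botL Γ Δ : prop_rule [::] (Bot +` Γ ⇒ Δ)
  | R_topR Γ Δ : prop_rule [::] (Γ ⇒ Top +` Δ)
  | R_negL Γ Δ A : prop_rule [:: Γ ⇒ A +` Δ] (Neg A +` Γ ⇒ Δ)
  | R_negR Γ Δ A : prop_rule [:: A +` Γ ⇒ Δ] (Γ ⇒ Neg A +` Δ)
  | R_andL Γ Δ A B : prop_rule [:: A +` (B +` Γ) ⇒ Δ] (And A B +` Γ ⇒ Δ)
  | R_andR Γ Δ A B :
      prop_rule [:: Γ ⇒ A +` Δ; Γ ⇒ B +` Δ] (Γ ⇒ And A B +` Δ)
  | R_orL Γ Δ A B :
      prop_rule [:: A +` Γ ⇒ Δ; B +` Γ ⇒ Δ] (Or A B +` Γ ⇒ Δ)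
  | R_orR Γ Δ A B : prop_rule [:: Γ ⇒ A +` (B +` Δ)] (Γ ⇒ Or A B +` Δ)
  | R_impL Γ Δ A B :
      prop_rule [:: Γ ⇒ A +` Δ; B +` Γ ⇒ Δ] (Imp A B +` Γ ⇒ Δ)
  | R_impR Γ Δ A B : prop_rule [:: A +` Γ ⇒ B +` Δ] (Γ ⇒ Imp A B +` Δ).

(* One-premiss structural rules, [rule premiss conclusion]. *)
Inductive contraction : sequent -> sequent -> Prop :=
  | R_conL Γ Δ A : contraction (A +` (A +` Γ) ⇒ Δ) (A +` Γ ⇒ Δ)
  | R_conR Γ Δ A : contraction (Γ ⇒ A +` (A +` Δ)) (Γ ⇒ A +` Δ).

Inductive weakening : sequent -> sequent -> Prop :=
  | R_wkL Γ Δ A : weakening (Γ ⇒ Δ) (A +` Γ ⇒ Δ)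
  | R_wkR Γ Δ A : weakening (Γ ⇒ Δ) (Γ ⇒ A +` Δ).

Definition contraction_or_weakening (s' s : sequent) : Prop :=
  contraction s' s \/ weakening s' s.

Inductive rule_E : seq sequent -> sequent -> Prop :=
  | R_E Γ Δ A B :
      rule_E [:: [mset A] ⇒ [mset B]; [mset B] ⇒ [mset A]]
             (Box A +` Γ ⇒ Box B +` Δ).

Inductive rule_M : seq sequent -> sequent -> Prop :=
  | R_M Γ Δ A B :
      rule_M [:: [mset A] ⇒ [mset B]] (Box A +` Γ ⇒ Box B +` Δ).

Inductive rule_N : seq sequent -> sequent -> Prop :=
  | R_N Γ Δ A : rule_N [:: mset0 ⇒ [mset A]] (Γ ⇒ Box A +` Δ).

Inductive rule_En (n : nat) : seq sequent -> sequent -> Prop :=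
  | R_En Γ Δ (As : n.-tuple form) B :
      rule_En n
        ((seq_mset As ⇒ [mset B]) :: [seq [mset B] ⇒ [mset A] | A <- As])
        (seq_mset [seq Box A | A <- As] `+` Γ ⇒ Box B +` Δ).

Inductive rule_Mn (n : nat) : seq sequent -> sequent -> Prop :=
  | R_Mn Γ Δ (As : n.-tuple form) B :
      rule_Mn n [:: seq_mset As ⇒ [mset B]]
        (seq_mset [seq Box A | A <- As] `+` Γ ⇒ Box B +` Δ).

Definition modal_rule (Ax : {pred modal_axiom})
    (ps : seq sequent) (s : sequent) : Prop :=
  match AxM \in Ax, AxC \in Ax, AxN \in Ax with
  | false, false, false => rule_E ps s
  | false, false, true => rule_E ps s \/ rule_N ps s
  | false, true, false => exists n, 1 <= n /\ rule_En n ps s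
  | false, true, true => (exists n, 1 <= n /\ rule_En n ps s) \/ rule_N ps s
  | true, false, false => rule_M ps s
  | true, false, true => rule_M ps s \/ rule_N ps s
  | true, true, false => exists n, 1 <= n /\ rule_Mn n ps s
  | true, true, true => exists n, rule_Mn n ps s
  end.

(* G_EA extended with the structural rules str. *)
Inductive G (Ax : {pred modal_axiom}) (str : sequent -> sequent -> Prop) :
    sequent -> Prop :=
  | G_prop ps s : prop_rule ps s ->
      (forall s', s' \in ps -> G Ax str s') -> G Ax str s
  | G_modal ps s : modal_rule Ax ps s ->
      (forall s', s' \in ps -> G Ax str s') -> G Ax str s
  | G_struct s' s : str s' s -> G Ax str s' -> G Ax str s.

(* Last s        stands for  s,
   LastE s t u   stands for  s /_e (t ; u),
   Nest s X      stands for  s / X. *)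
Inductive lns : Type :=
  | Last of sequent
  | LastE of sequent & sequent & sequent
  | Nest of sequent & lns.

(* Gs / X, for a possibly empty sequence Gs of components. *)
Definition prepend (Gs : seq sequent) (X : lns) : lns := foldr Nest X Gs.

(* The contexts S{ } whose hole is a component outside /_e. *)
Inductive lns_ctx : Type :=
  | HoleLast
  | HoleE of sequent & sequent
  | HoleNest of lns
  | Under of sequent & lns_ctx.

Fixpoint fill (S : lns_ctx) (s : sequent) : lns :=
  match S with
  | HoleLast => Last s
  | HoleE t u => LastE s t u
  | HoleNest X => Nest s X
  | Under r S' => Nest r (fill S' s)
  end.

(* LNS_EA extended with the structural rules str. Unlike the propositional
   rules, the structural rules also apply to the two sequents inside /_e. *)
Inductive LNS (Ax : {pred modal_axiom}) (str : sequent -> sequent -> Prop) :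
    lns -> Prop :=
  | L_prop S ps s : prop_rule ps s ->
      (forall s', s' \in ps -> LNS Ax str (fill S s')) ->
      LNS Ax str (fill S s)
  | L_boxR Gs Γ Δ B :
      LNS Ax str
        (prepend Gs (LastE (Γ ⇒ Δ) (mset0 ⇒ [mset B]) ([mset B] ⇒ mset0))) ->
      LNS Ax str (prepend Gs (Last (Γ ⇒ Box B +` Δ)))
  | L_boxL Gs Γ Δ Σ Π Ω Θ A :
      LNS Ax str (prepend Gs (Nest (Γ ⇒ Δ) (Last (A +` Σ ⇒ Π)))) ->
      LNS Ax str (prepend Gs (Nest (Γ ⇒ Δ) (Last (Ω ⇒ A +` Θ)))) ->
      LNS Ax str (prepend Gs (LastE (Box A +` Γ ⇒ Δ) (Σ ⇒ Π) (Ω ⇒ Θ)))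
  | L_N Gs Γ Δ B : AxN \in Ax ->
      LNS Ax str (prepend Gs (Nest (Γ ⇒ Δ) (Last (mset0 ⇒ [mset B])))) ->
      LNS Ax str (prepend Gs (Last (Γ ⇒ Box B +` Δ)))
  | L_M Gs s Σ Π Ω Θ : AxM \in Ax ->
      LNS Ax str (prepend Gs (LastE s (Σ ⇒ Π) (Bot +` Ω ⇒ Θ))) ->
      LNS Ax str (prepend Gs (LastE s (Σ ⇒ Π) (Ω ⇒ Θ)))
  | L_C Gs Γ Δ Σ Π Ω Θ A : AxC \in Ax ->
      LNS Ax str (prepend Gs (LastE (Γ ⇒ Δ) (A +` Σ ⇒ Π) (Ω ⇒ Θ))) ->
      LNS Ax str (prepend Gs (Nest (Γ ⇒ Δ) (Last (Ω ⇒ A +` Θ)))) ->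
      LNS Ax str (prepend Gs (LastE (Box A +` Γ ⇒ Δ) (Σ ⇒ Π) (Ω ⇒ Θ)))
  | L_struct S s' s : str s' s ->
      LNS Ax str (fill S s') -> LNS Ax str (fill S s)
  | L_structE1 Gs s t' t u : str t' t ->
      LNS Ax str (prepend Gs (LastE s t' u)) ->
      LNS Ax str (prepend Gs (LastE s t u))
  | L_structE2 Gs s t u' u : str u' u ->
      LNS Ax str (prepend Gs (LastE s t u')) ->
      LNS Ax str (prepend Gs (LastE s t u)).

(* Main.v *)
Require Import Defs.
From mathcomp Require Import all_boot.
From mathcomp Require Import finmap multiset.
Local Open Scope mset_scope.

(** If a linear nested sequent is derivable, then one of its components is
    derivable in the sequent calculus. For this to go through by induction, a
    final component [s] followed by [/_e (t ; u)] has to be read as [s] enlarged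
    by the principal formulas already absorbed by the block: if the block was
    opened by [Box B] and has since taken in [Box A], for [A] in [As], then
    [s] with [Box As] added on the left and [Box B] on the right is derivable.
    Up to contraction and weakening, [t] and [u] are then [As ⇒ B] and [B ⇒],
    so that closing the block with the left box rule is one application of a
    modal sequent rule.

    For the Hilbert system, a sequent is read as the implication from the
    conjunction of its antecedent to the disjunction of its succedent. *)

Section Translation.

Set Implicit Arguments.
Unset Strict Implicit.

Variable Ax : {pred modal_axiom}.
Implicit Types (A B : form) (As : seq form) (Γ Δ : {mset form}).
Implicit Types (l : seq form) (ps : seq sequent) (c s t u : sequent) (X Y : lns) (v : nat -> bool) (b : form -> bool).

Local Notation G := (G Ax contraction).

(** * Sequent rules under an enlarged context *)

Definition addseq c s : sequent := (c.1 `+` s.1, c.2 `+` s.2).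

Lemma prop_rule_addseq c ps s :
  prop_rule ps s -> prop_rule (map (addseq c) ps) (addseq c s).
Proof.
case: c => C D; case=> *; rewrite /addseq /= ?(msetDCA C) ?(msetDCA D).
- exact: R_init.
- exact: R_botL.
- exact: R_topR.
- exact: R_negL.
- exact: R_negR.
- exact: R_andL.
- exact: R_andR.
- exact: R_orL.
- exact: R_orR.
- exact: R_impL.
- exact: R_impR.
Qed.

Lemma contraction_addseq c s' s :
  contraction s' s -> contraction (addseq c s') (addseq c s).
Proof.
case: c => C D [] Γ Δ A; rewrite /addseq /= ?(msetDCA C) ?(msetDCA D).
- exact: R_conL.
- exact: R_conR.
Qed.

(** * A uniform shape for the modal sequent rules *)

Lemma seq_mset0 : seq_mset [::] = mset0 :> {mset form}.
Proof. by apply/msetP=> x; rewrite mset_seqE mset0E. Qed.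

Lemma seq_mset1 A : seq_mset [:: A] = [mset A].
Proof. by rewrite mset_cons seq_mset0 msetD0. Qed.

(* No boxed formula on the left: rule (N); one: (E) or (M); several: (En) or
   (Mn), hence C. *)
Definition box_arity As : Prop :=
  (As = [::] -> AxN \in Ax) /\ (1 < size As -> AxC \in Ax).

(** Premisses are only required to occur in [ps], so that one shape covers the modal rules of all
    eight systems. *)
Definition box_rule (As : seq form) (B : form) (ps : seq sequent) (s : sequent)
    : Prop :=
  [/\ box_arity As,
      exists Γ Δ, s = (seq_mset (map Box As) `+` Γ ⇒ Box B +` Δ),
      (seq_mset As ⇒ [mset B]) \in ps &
      AxM \in Ax \/ forall A, A \in As -> ([mset B] ⇒ [mset A]) \in ps].

Lemma rule_E_box ps s : rule_E ps s -> exists As B, box_rule As B ps s.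
Proof.
case=> Γ Δ A B; exists [:: A], B; split=> //.
- by exists Γ, Δ; rewrite /= seq_mset1.
- by rewrite seq_mset1 inE eqxx.
- by right=> C; rewrite inE => /eqP->; rewrite !inE eqxx orbT.
Qed.

Lemma rule_M_box ps s :
  AxM \in Ax -> rule_M ps s -> exists As B, box_rule As B ps s.
Proof.
move=> hM [Γ Δ A B]; exists [:: A], B; split=> //.
- by exists Γ, Δ; rewrite /= seq_mset1.
- by rewrite seq_mset1 inE eqxx.
- by left.
Qed.

Lemma rule_N_box ps s :
  AxN \in Ax -> rule_N ps s -> exists As B, box_rule As B ps s.
Proof.
move=> hN [Γ Δ B]; exists [::], B; split=> //.
- by exists Γ, Δ; rewrite /= seq_mset0 mset0D.
- by rewrite seq_mset0 inE eqxx.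
- by right.
Qed.

Lemma rule_En_box n ps s : AxC \in Ax ->
  1 <= n -> rule_En n ps s -> exists As B, box_rule As B ps s.
Proof.
move=> hC n_gt0 [Γ Δ As B]; exists As, B; split=> //.
- by split=> // As0; move: n_gt0; rewrite -(size_tuple As) As0.
- by exists Γ, Δ.
- by rewrite inE eqxx.
- right=> A hA; rewrite inE; apply/orP; right.
  exact: (map_f (fun A => [mset B] ⇒ [mset A])).
Qed.

Lemma rule_Mn_box n ps s : AxC \in Ax -> AxM \in Ax ->
  (n = 0 -> AxN \in Ax) -> rule_Mn n ps s -> exists As B, box_rule As B ps s.
Proof.
move=> hC hM n0 [Γ Δ As B]; exists As, B; split=> //.
- by split=> // As0; apply: n0; rewrite -(size_tuple As) As0.
- by exists Γ, Δ.
- by rewrite inE eqxx.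
- by left.
Qed.

Lemma modal_rule_box ps s :
  modal_rule Ax ps s -> exists As B, box_rule As B ps s.
Proof.
rewrite /modal_rule; case hM: (AxM \in Ax); case hC: (AxC \in Ax);
  case hN: (AxN \in Ax).
- by case=> n; apply: rule_Mn_box.
- by case=> n [n_gt0]; apply: rule_Mn_box => // n0; rewrite n0 in n_gt0.
- by case; [apply: rule_M_box | apply: rule_N_box].
- exact: rule_M_box.
- by case; [case=> n []; apply: rule_En_box | apply: rule_N_box].
- by case=> n []; apply: rule_En_box.
- by case; [apply: rule_E_box | apply: rule_N_box].
- exact: rule_E_box.
Qed.

(** Converse to [modal_rule_box]; the length of [As] selects the rule. Length 0 takes (N), or (Mn)
    with n = 0 when M and C are both present; length 1 takes (E) or (M), or under C an n-ary rule
    with n = 1; greater lengths have C by [box_arity]. *)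
Lemma G_box As B Γ Δ : box_arity As ->
  G (seq_mset As ⇒ [mset B]) ->
  (AxM \in Ax \/ forall A, A \in As -> G ([mset B] ⇒ [mset A])) ->
  G (seq_mset (map Box As) `+` Γ ⇒ Box B +` Δ).
Proof.
move=> [hN hC] hAB hBA.
have rMn : rule_Mn (size As) [:: seq_mset As ⇒ [mset B]]
    (seq_mset (map Box As) `+` Γ ⇒ Box B +` Δ).
  exact: (R_Mn Γ Δ (in_tuple As)).
have rEn : rule_En (size As)
    ((seq_mset As ⇒ [mset B]) :: [seq [mset B] ⇒ [mset A] | A <- As])
    (seq_mset (map Box As) `+` Γ ⇒ Box B +` Δ).
  exact: (R_En Γ Δ (in_tuple As)).
have G1 s' : s' \in [:: seq_mset As ⇒ [mset B]] -> G s'.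
  by rewrite inE => /eqP->.
have Gn s' : AxM \in Ax = false ->
    s' \in (seq_mset As ⇒ [mset B]) :: [seq [mset B] ⇒ [mset A] | A <- As] ->
    G s'.
  move=> nM; rewrite inE => /orP[/eqP->//|/mapP[A hA ->]].
  by case: hBA => [|]; [rewrite nM | apply].
have [As0|As_gt0] := posnP (size As).
  move/size0nil: As0 => As0; have {}hN := hN As0.
  apply: G_modal G1; rewrite /modal_rule hN.
  have rN : rule_N [:: seq_mset As ⇒ [mset B]]
      (seq_mset (map Box As) `+` Γ ⇒ Box B +` Δ).
    by rewrite As0 /= seq_mset0 mset0D; apply: R_N.
  case: (AxM \in Ax); case: (AxC \in Ax); try by right.
  by exists (size As).
have [As_gt1|] := ltnP 1 (size As); last first.
  case: As As_gt0 {hN hC hBA hAB} rMn rEn G1 Gn => [|A [|//]] //= _ rMn rEn G1 Gn _.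
  rewrite /= !seq_mset1 in rMn rEn G1 Gn *.
  case hM: (AxM \in Ax).
    have rM := R_M Γ Δ A B.
    apply: G_modal G1; rewrite /modal_rule hM.
    by case: (AxC \in Ax); case: (AxN \in Ax) => //; by [left | exists 1].
  have rE := R_E Γ Δ A B.
  apply: G_modal => [|s']; last exact: Gn.
  rewrite /modal_rule hM.
  by case: (AxC \in Ax); case: (AxN \in Ax) => //;
    by [left | exists 1 | left; exists 1].
have {}hC := hC As_gt1.
case hM: (AxM \in Ax).
  apply: G_modal G1; rewrite /modal_rule hM hC.
  by case: (AxN \in Ax); exists (size As).
apply: G_modal => [|s']; last exact: Gn.
by rewrite /modal_rule hM hC; case: (AxN \in Ax); [left|];
  exists (size As).
Qed.

(** * Admissible weakening; derivability up to multiplicity *)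

(** Modal conclusions carry arbitrary side formulas, so a modal step absorbs [c] there and keeps its
    premisses; the other rules pass [c] up to theirs. *)
Lemma G_weaken c s : G s -> G (addseq c s).
Proof.
elim=> {s} [ps s r _ IH|ps s r G0 _|s' s r _ IH].
- apply: (G_prop (prop_rule_addseq c r)) => _ /mapP[s' hs' ->]; exact: IH.
- have [As [B [arity [Γ [Δ ->]] hAB hBA]]] := modal_rule_box r.
  rewrite /addseq /= msetDCA (msetDCA c.2).
  apply: G_box => //; first exact: G0.
  by case: hBA => [|h]; [left | right=> A hA; apply/G0/h].
- exact: (G_struct (contraction_addseq c r)).
Qed.

Lemma G_contractL l Γ Δ :
  {subset l <= Γ} -> G (seq_mset l `+` Γ ⇒ Δ) -> G (Γ ⇒ Δ).
Proof.
elim: l => [|A l IH] sub; first by rewrite seq_mset0 mset0D.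
have AΓ : A \in Γ by apply: sub; rewrite inE eqxx.
have {IH} := IH _; move=> IH h; apply: IH.
  by move=> C hC; apply: sub; rewrite inE hC orbT.
rewrite -(msetB1K AΓ) msetDCA; apply: (G_struct (R_conL _ _ _)).
by rewrite (msetDCA [mset A] (seq_mset l)) (msetB1K AΓ) msetDA -mset_cons.
Qed.

Lemma G_contractR l Γ Δ :
  {subset l <= Δ} -> G (Γ ⇒ seq_mset l `+` Δ) -> G (Γ ⇒ Δ).
Proof.
elim: l => [|A l IH] sub; first by rewrite seq_mset0 mset0D.
have AΔ : A \in Δ by apply: sub; rewrite inE eqxx.
have {IH} := IH _; move=> IH h; apply: IH.
  by move=> C hC; apply: sub; rewrite inE hC orbT.
rewrite -(msetB1K AΔ) msetDCA; apply: (G_struct (R_conR _ _ _)).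
by rewrite (msetDCA [mset A] (seq_mset l)) (msetB1K AΔ) msetDA -mset_cons.
Qed.

(** Weaken by [Γ'] and [Δ'], then contract every formula of [Γ] and [Δ] into its copy there. *)
Lemma G_subset Γ Δ Γ' Δ' : {subset Γ <= Γ'} -> {subset Δ <= Δ'} ->
  G (Γ ⇒ Δ) -> G (Γ' ⇒ Δ').
Proof.
move=> subΓ subΔ /(G_weaken (Γ', Δ')); rewrite /addseq /=.
rewrite msetDC (msetDC Δ') => h.
apply: (G_contractL subΓ); apply: (G_contractR subΔ).
by rewrite !seq_mset_id.
Qed.

(** * Reading linear nested sequents *)

Lemma mem_seq_mset l A : (A \in seq_mset l) = (A \in l).
Proof. exact: (perm_mem (perm_eq_seq_mset l)). Qed.

(* With M the second sequent may have acquired [Bot], so that nothing is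
   required of it. *)
Definition block As B t u : Prop :=
  [/\ {subset t.1 <= As}, {subset t.2 <= [mset B]},
      As = [::] \/ AxC \in Ax &
      AxM \in Ax \/
      [/\ {subset u.1 <= [mset B]}, {subset u.2 <= mset0 : {mset form}} &
        forall A, A \in As -> G ([mset B] ⇒ [mset A])]].

(** The structure does not record which boxed formulas opened and fed a block, hence the
    quantification over all [As] and [B] compatible with it. *)
Fixpoint some_derivable X : Prop :=
  match X with
  | Last s => G s
  | LastE s t u => forall As B, block As B t u ->
      G (addseq (seq_mset (map Box As), [mset Box B]) s)
  | Nest s X => G s \/ some_derivable X
  end.

(** Different premisses may have different derivable components: either the active one is derivable
    in all of them, or some premiss has a derivable passive one, which the conclusion shares. *)
Lemma all_or_some (ps : seq sequent) (P : sequent -> Prop) (Q : Prop) :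
  (forall s, s \in ps -> P s \/ Q) -> (forall s, s \in ps -> P s) \/ Q.
Proof.
elim: ps => [|s ps IH] h; first by left.
have [|Ps|] := h s; [by rewrite inE eqxx| |by right].
have [s' hs'|Pps|] := IH; [by apply: h; rewrite inE hs' orbT| |by right].
by left=> s'; rewrite inE => /orP[/eqP->|/Pps].
Qed.

(** Closure under every added [c] serves the hole before [/_e], where the component is read together
    with boxed formulas. *)
Lemma some_derivable_fill S (ps : seq sequent) s :
  (forall c, (forall s', s' \in ps -> G (addseq c s')) -> G (addseq c s)) ->
  (forall s', s' \in ps -> some_derivable (fill S s')) ->
  some_derivable (fill S s).
Proof.
move=> rule; have add0 s' : addseq (mset0, mset0) s' = s'.
  by case: s' => Γ Δ; rewrite /addseq !mset0D.
have rule0 : (forall s', s' \in ps -> G s') -> G s.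
  move=> h; rewrite -(add0 s); apply: rule => s' hs'.
  by rewrite add0; apply: h.
elim: S => [|t u|X|r S IH] /= h.
- exact: rule0.
- by move=> As B hb; apply: rule => s' hs'; apply: h.
- by case: (all_or_some h) => [/rule0|]; [left|right].
- have [|/IH|] := @all_or_some ps (fun s' => some_derivable (fill S s')) (G r).
  + by move=> s' /h; tauto.
  + by right.
  + by left.
Qed.

Lemma some_derivable_prepend2 Gs X X' Y :
  (some_derivable X -> some_derivable X' -> some_derivable Y) ->
  some_derivable (prepend Gs X) -> some_derivable (prepend Gs X') ->
  some_derivable (prepend Gs Y).
Proof. by move=> h; elim: Gs => //= s Gs IH; tauto. Qed.

Lemma some_derivable_prepend Gs X Y :
  (some_derivable X -> some_derivable Y) ->
  some_derivable (prepend Gs X) -> some_derivable (prepend Gs Y).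
Proof. by move=> h; elim: Gs => //= s Gs IH; tauto. Qed.

Lemma structural_subset s' s : contraction_or_weakening s' s ->
  {subset s'.1 <= s.1} /\ {subset s'.2 <= s.2}.
Proof.
by case=> -[] *; split=> C /=; rewrite ?in_mset1D ?orbA ?orbb // => ->; rewrite ?orbT.
Qed.

Lemma G_structural s' s : contraction_or_weakening s' s -> G s' -> G s.
Proof.
case: s' s => Γ Δ [Γ' Δ'] /structural_subset[/= ? ?]; exact: G_subset.
Qed.

Lemma structural_addseq c s' s : contraction_or_weakening s' s ->
  contraction_or_weakening (addseq c s') (addseq c s).
Proof.
case=> [h|]; first by left; apply: contraction_addseq.
case: c => C D [] Γ Δ A; right; rewrite /addseq /= ?(msetDCA C) ?(msetDCA D).
- exact: R_wkL.
- exact: R_wkR.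
Qed.

Lemma block_subset As B t t' u u' :
  {subset t'.1 <= t.1} -> {subset t'.2 <= t.2} ->
  {subset u'.1 <= u.1} -> {subset u'.2 <= u.2} ->
  block As B t u -> block As B t' u'.
Proof.
move=> t1 t2 u1 u2 [b1 b2 b3 b4]; split=> //.
- by move=> C /t1/b1.
- by move=> C /t2/b2.
case: b4 => [|[v1 v2 BA]]; [by left | right; split=> //].
- by move=> C /u1/v1.
- by move=> C /u2/v2.
Qed.

(** In the second alternative of [block], [Ω] contains at most copies of [B] and [Θ] is empty, so
    the premiss yields [B ⇒ A]. *)
Lemma block_right As B t Ω Θ A : block As B t (Ω ⇒ Θ) ->
  G (Ω ⇒ A +` Θ) ->
  AxM \in Ax \/ forall C, C \in A :: As -> G ([mset B] ⇒ [mset C]).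
Proof.
case=> _ _ _ [|[/= sΩ sΘ BA] h]; [by left | right=> C].
rewrite inE => /orP[/eqP->|/BA//]; apply: (G_subset _ _ h) => //.
by move=> D; rewrite in_mset1D => /orP[|/sΘ]; rewrite ?in_mset1 // in_mset0.
Qed.

(** Leaving [str] open serves both halves of the theorem; weakening, if present, disappears because
    it is admissible in the sequent calculus. *)
Lemma LNS_some_derivable str X :
  (forall s' s, str s' s -> contraction_or_weakening s' s) ->
  LNS Ax str X -> some_derivable X.
Proof.
move=> hstr; elim=> {X}.
- move=> S ps s r _ IH; apply: some_derivable_fill IH => c h.
  by apply: (G_prop (prop_rule_addseq c r)) => _ /mapP[s' hs' ->]; apply: h.
- move=> Gs Γ Δ B _; apply: some_derivable_prepend => /= h.
  (* A freshly opened block has absorbed nothing yet, so [As] is empty. *)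
  have := h [::] B; rewrite /addseq /= seq_mset0 mset0D; apply.
  split=> //=; [by move=> C; rewrite in_mset0 | by left | by right; split].
- move=> Gs Γ Δ Σ Π Ω Θ A _ + _; apply: some_derivable_prepend2 => /=.
  have wk As B : G (Γ ⇒ Δ) ->
      G (addseq (seq_mset (map Box As), [mset Box B]) (Box A +` Γ ⇒ Δ)).
    by apply: G_subset => C /= hC; rewrite !in_msetD hC !orbT.
  move=> [h _ As B _|h1]; first exact: wk.
  move=> [h As B _|h2 As B hb]; first exact: wk.
  rewrite /addseq /= msetDCA msetDA -mset_cons.
  (* Closing the block: [A] joins [As], and both premisses shrink to those of one modal rule. C is
     needed only if [As] was nonempty. *)
  case: (hb) => /= s1 s2 hC _; apply: (@G_box (A :: As)).
  + split=> // As_gt0; case: hC => // As0; by rewrite As0 in As_gt0.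
  + apply: (G_subset _ s2 h1) => C.
    by rewrite in_mset1D mem_seq_mset inE => /orP[->|/s1->]; rewrite ?orbT.
  + exact: block_right hb h2.
- move=> Gs Γ Δ B hN _; apply: some_derivable_prepend => /= -[h|h].
    by apply: G_subset h => // C hC; rewrite in_mset1D hC orbT.
  rewrite -(mset0D Γ) -seq_mset0; apply: (@G_box [::]); first by split.
    by rewrite seq_mset0.
  by right.
- move=> Gs s Σ Π Ω Θ hM _; apply: some_derivable_prepend => /= h As B hb.
  by apply: h; case: hb => h1 h2 h3 _; split=> //; left.
- move=> Gs Γ Δ Σ Π Ω Θ A hC _ + _; apply: some_derivable_prepend2 => /=.
  move=> h1 [h|h2] As B hb.
    by apply: G_subset h => C /= hC'; rewrite !in_msetD hC' !orbT.
  rewrite /addseq /= msetDCA msetDA -mset_cons.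
  (* The block stays open, now with [A] counted among the absorbed formulas. *)
  apply: (h1 (A :: As)); case: (hb) => /= s1 s2 _ hBA; split=> //=; [|by right|].
  + move=> C; rewrite in_mset1D inE => /orP[->//|/s1->]; exact: orbT.
  + have := block_right hb h2; case: hBA => [|[? ? _]]; first by left.
    by case=> [|?]; [left | right].
- move=> S s' s /hstr r _ IH.
  apply: (@some_derivable_fill S [:: s']) => [c h|t].
    by apply: (G_structural (structural_addseq c r)); apply: h; rewrite inE.
  by rewrite inE => /eqP->.
- move=> Gs s t' t u /hstr/structural_subset[s1 s2] _.
  apply: some_derivable_prepend => /= h As B hb.
  by apply: h; apply: block_subset hb.
- move=> Gs s t u' u /hstr/structural_subset[s1 s2] _.
  apply: some_derivable_prepend => /= h As B hb.
  by apply: h; apply: block_subset hb.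
Qed.

(** * Soundness of the sequent calculus for the Hilbert system *)

Definition seq_form s : form := Imp (foldr And Top s.1) (foldr Or Bot s.2).

Lemma eval_conj v b l : eval v b (foldr And Top l) = all (eval v b) l.
Proof. by elim: l => //= A l ->. Qed.

Lemma eval_disj v b l : eval v b (foldr Or Bot l) = has (eval v b) l.
Proof. by elim: l => //= A l ->. Qed.

(** Discharging the members of [l] one by one into implications leaves a tautology; modus ponens
    then restores [A]. *)
Lemma Hilbert_conseq l A :
  (forall B, B \in l -> Hilbert Ax B) ->
  (forall v b, all (eval v b) l -> eval v b A) -> Hilbert Ax A.
Proof.
elim: l A => [|B l IH] A hl hA; first by apply: H_taut => v b; apply: hA.
apply: (@H_mp _ B); last by apply: hl; rewrite inE eqxx.
apply: IH => [C hC|v b all_l /=]; first by apply: hl; rewrite inE hC orbT.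
by apply/implyP=> evB; apply: hA; rewrite /= evB.
Qed.

Lemma all_mset1D (P : pred form) A Γ : all P (A +` Γ) = P A && all P Γ.
Proof. by rewrite (@eq_all_r _ _ (A :: Γ)) // => C; rewrite in_mset1D inE. Qed.

Lemma has_mset1D (P : pred form) A Γ : has P (A +` Γ) = P A || has P Γ.
Proof. by rewrite (@eq_has_r _ _ (A :: Γ)) // => C; rewrite in_mset1D inE. Qed.

Lemma all_mset1 (P : pred form) A : all P [mset A] = P A.
Proof.
by rewrite (@eq_all_r _ _ [:: A]) /= ?andbT // => C; rewrite in_mset1 inE.
Qed.

Lemma has_mset1 (P : pred form) A : has P [mset A] = P A.
Proof.
by rewrite (@eq_has_r _ _ [:: A]) /= ?orbF // => C; rewrite in_mset1 inE.
Qed.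

Lemma all_seq_mset (P : pred form) l : all P (seq_mset l) = all P l.
Proof. exact/eq_all_r/mem_seq_mset. Qed.

Lemma all_msetD (P : pred form) Γ Δ : all P (Γ `+` Δ) = all P Γ && all P Δ.
Proof.
by rewrite -all_cat; apply: eq_all_r => C; rewrite in_msetD mem_cat.
Qed.

(** Truth is preserved at each single valuation, as [Hilbert_conseq] demands, and not merely
    validity. *)
Lemma prop_rule_sound v b ps s :
  prop_rule ps s -> all (fun s' => eval v b (seq_form s')) ps ->
  eval v b (seq_form s).
Proof.
by case=> >; rewrite /= !eval_conj !eval_disj ?all_mset1D ?has_mset1D /=;
  repeat match goal with
  | |- context [eval v b ?A] => case: (eval v b A)
  | |- context [v ?p] => case: (v p)
  | |- context [all ?P ?l] => case: (all P l)
  | |- context [has ?P ?l] => case: (has P l)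
  end.
Qed.

Lemma contraction_sound v b s' s :
  contraction s' s -> eval v b (seq_form s') -> eval v b (seq_form s).
Proof.
by case=> Γ Δ A; rewrite /= !eval_conj !eval_disj ?all_mset1D ?has_mset1D
  ?andbA ?andbb ?orbA ?orbb.
Qed.

(** N settles the empty list and C each formula beyond the first. A singleton is a base case of its
    own, by (E) from [A] to [And A Top], since N may be absent. *)
Lemma Hilbert_box_conj As : box_arity As ->
  Hilbert Ax (Imp (foldr And Top (map Box As)) (Box (foldr And Top As))).
Proof.
elim: As => [[hN _]|A [|A' As] IH [_ hC]].
- apply: (@Hilbert_conseq [:: Box Top]) => [B|v b].
    rewrite inE => /eqP->; apply: (H_axiom (hN erefl)); exact: instN.
  by rewrite /= andbT.
- apply: (@Hilbert_conseq [:: Imp (Box A) (Box (And A Top))]) => [B|v b].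
    by rewrite inE => /eqP->; apply: H_E; apply: H_taut => v b /=;
      case: (eval v b A).
  by rewrite /= !andbT.
- have {}hC := hC isT; set Ds := foldr And Top (A' :: As) in IH *.
  apply: (@Hilbert_conseq
    [:: Imp (foldr And Top (map Box (A' :: As))) (Box Ds);
        Imp (And (Box A) (Box Ds)) (Box (And A Ds))]) => [B|v b].
    rewrite !inE => /orP[/eqP->|/eqP->]; last exact: (H_axiom hC (instC _ _)).
    by apply: IH; split.
  rewrite -/Ds map_cons [foldr _ _ (_ :: map _ _)]/= [all _ _]/= andbT.
  move=> /andP[h1 h2] /=; apply/implyP=> /andP[bA hAs].
  have bD : b Ds by apply: (implyP h1).
  by move: h2; rewrite /= bA bD.
Qed.

(** If [A] implies [B], then [A] is equivalent to [And A B]; (E) boxes this, and M extracts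
    [Box B]. *)
Lemma Hilbert_monotone A B : AxM \in Ax ->
  Hilbert Ax (Imp A B) -> Hilbert Ax (Imp (Box A) (Box B)).
Proof.
move=> hM hAB.
apply: (@Hilbert_conseq [:: Imp (Box A) (Box (And A B));
    Imp (Box (And A B)) (And (Box A) (Box B))]) => [C|v b].
  rewrite !inE => /orP[/eqP->|/eqP->]; last exact: (H_axiom hM (instM _ _)).
  apply: H_E; first (apply: (@Hilbert_conseq [:: Imp A B]) => [D|v b]).
  - by rewrite inE => /eqP->.
  - by rewrite /=; case: (eval v b A); case: (eval v b B).
  - by apply: H_taut => v b /=; apply/implyP=> /andP[].
by rewrite /=; case: (b A); case: (b B); case: (b (And A B)).
Qed.

Lemma G_Hilbert s : G s -> Hilbert Ax (seq_form s).
Proof.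
elim=> {s} [ps s r _ IH|ps s r _ IH|s' s r _ IH].
- apply: (@Hilbert_conseq (map seq_form ps)) => [_ /mapP[s' hs' ->]|v b h].
    exact: IH.
  by apply: (prop_rule_sound r); rewrite all_map in h.
- have [As [B [arity [Γ [Δ ->]] /IH hAB hBA]]] := modal_rule_box r.
  set D := foldr And Top As.
  have DB : Hilbert Ax (Imp D B).
    apply: (@Hilbert_conseq [:: seq_form (seq_mset As ⇒ [mset B])]) => [C|v b].
      by rewrite inE => /eqP->.
    by rewrite /= andbT !eval_conj !eval_disj all_seq_mset has_mset1.
  have boxDB : Hilbert Ax (Imp (Box D) (Box B)).
    case: hBA => [hM|hBA]; first exact: Hilbert_monotone.
    (* The premisses [B ⇒ A], for [A] in [As], together give the converse implication from [B] to
       [D]. *)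
    apply: H_E => //.
    apply: (@Hilbert_conseq [seq seq_form ([mset B] ⇒ [mset A]) | A <- As]).
      by move=> _ /mapP[A /hBA/IH hA ->].
    move=> v b; rewrite all_map => /allP h /=; apply/implyP=> evB.
    rewrite /D eval_conj; apply/allP=> A /h.
    by rewrite /= eval_conj eval_disj all_mset1 has_mset1 evB.
  apply: (@Hilbert_conseq [:: Imp (foldr And Top (map Box As)) (Box D);
    Imp (Box D) (Box B)]) => [C|v b].
    by rewrite !inE => /orP[/eqP->|/eqP->]; first exact: Hilbert_box_conj.
  rewrite /= !eval_conj eval_disj all_msetD all_seq_mset has_mset1D /= andbT.
  by case: (all _ _); case: (b D); case: (b B); rewrite //= implybT.
- apply: (@Hilbert_conseq [:: seq_form s']) => [C|v b].
    by rewrite inE => /eqP->.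
  by rewrite /= andbT; apply: contraction_sound.
Qed.

End Translation.

Theorem mainTheorem10 (Ax : {pred modal_axiom}) :
  (forall Γ Δ : {mset form},
     LNS Ax contraction (Last (Γ ⇒ Δ)) -> G Ax contraction (Γ ⇒ Δ)) /\
  (forall A : form,
     LNS Ax contraction_or_weakening (Last (mset0 ⇒ [mset A])) ->
     Hilbert Ax A).
Proof.
split=> [Γ Δ h|A h].
  by apply: (LNS_some_derivable (X := Last (Γ ⇒ Δ)) _ h) => s' s; left.
have /G_Hilbert hA := LNS_some_derivable (fun _ _ r => r) h.
apply: (Hilbert_conseq (l := [:: seq_form (mset0 ⇒ [mset A])])) => [B|v b].
  by rewrite inE => /eqP->.
(* The empty antecedent has the members of the empty list, so its conjunction is true. *)
rewrite /= andbT eval_conj eval_disj has_mset1 (eq_all_r (s2 := [::])) //.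
by move=> C; rewrite in_mset0.
Qed.
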